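(* Let $G$ be a connected $d$-regular graph on $n\ge 3$ vertices with vertex set $I=\{1,\ldots,n\}$, and let $\lambda_1\ge\cdots\ge\lambda_n$ be the eigenvalues of its adjacency matrix. For $i\in I$ and distinct $j,k\in I\setminus\{i\}$ define $$\alpha_{ijk}=\begin{cases}-1-2\sqrt{(d-N(i,j)-1)(d-N(i,k)-1)},& j\sim i,\ k\sim i,\\ -2\sqrt{(d-N(i,j))(d-N(i,k))},& j\nsim i,\ k\nsim i,\\ -\tfrac12-\sqrt{\tfrac14+4(d-N(i,j)-1)(d-N(i,k))},& j\sim i,\ k\nsim i,\end{cases}$$ $$\beta_{ijk}=\begin{cases}-1+2\sqrt{(d-N(i,j)-1)(d-N(i,k)-1)},& j\sim i,\ k\sim i,\\ 2\sqrt{(d-N(i,j))(d-N(i,k))},& j\nsim i,\ k\nsim i,\\ -\tfrac12+\sqrt{\tfrac14+4(d-N(i,j)-1)(d-N(i,k))},& j\sim i,\ k\nsim i,\end{cases}$$ and, in the remaining case $j\nsim i,\ k\sim i$, set $\alpha_{ijk}=\alpha_{ikj}$ and $\beta_{ijk}=\beta_{ikj}$. Then $$\max_{i\in I}\ \min_{\substack{j,k\in I\setminus\{i\}\\ j\neq k}}\alpha_{ijk}\le\lambda_n\le\lambda_2\le\min_{i\in I}\ \max_{\substack{j,k\in I\setminus\{i\}\\ j\neq k}}\beta_{ijk}.$$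
   Context: Graphs are simple, finite and undirected; $j\sim i$ means $j$ and $i$ are adjacent. $N(i,j)$ denotes the number of common neighbours of distinct vertices $i,j$. The adjacency matrix has $(i,j)$ entry $1$ if $i\sim j$ and $0$ otherwise. *)

(* Defs.v *)
From mathcomp Require Import all_boot all_order all_algebra.

Set Implicit Arguments.
Unset Strict Implicit.
Unset Printing Implicit Defensive.

Import Order.TTheory GRing.Theory Num.Theory.
Local Open Scope ring_scope.

(* Maximum and minimum of a nonempty finite list. The unit passed to the big
   operator is an element of the list, so no foreign default value takes part;
   the value 0 on the empty list is junk. *)
Definition maxs (R : realDomainType) (s : seq R) : R :=
  \big[Num.max/head 0 s]_(x <- s) x.
Definition mins (R : realDomainType) (s : seq R) : R :=
  \big[Num.min/head 0 s]_(x <- s) x.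

Lemma maxs_ub (R : realDomainType) (s : seq R) x : x \in s -> x <= maxs s.
Proof. by move=> xs; exact: (@le_bigmax_seq _ _ _ s _ x xpredT id). Qed.

Lemma mins_lb (R : realDomainType) (s : seq R) x : x \in s -> mins s <= x.
Proof. by move=> xs; exact: (@ge_bigmin_seq _ _ _ s _ x xpredT id). Qed.

Lemma maxs_mem (R : realDomainType) (s : seq R) : s != [::] -> maxs s \in s.
Proof.
case: s => // a s _; rewrite /maxs big_seq.
apply: (big_ind (fun y => y \in a :: s)) => //=; first exact: mem_head.
by move=> x y xs ys; rewrite /Num.max; case: ifP.
Qed.

Lemma mins_mem (R : realDomainType) (s : seq R) : s != [::] -> mins s \in s.
Proof.
case: s => // a s _; rewrite /mins big_seq.
apply: (big_ind (fun y => y \in a :: s)) => //=; first exact: mem_head.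
by move=> x y xs ys; rewrite /Num.min; case: ifP.
Qed.

Section Graph.
Variables (R : rcfType) (n : nat).
Implicit Types (adj : rel 'I_n) (d : nat) (i j k : 'I_n).

Definition simple_graph adj := symmetric adj /\ irreflexive adj.

Definition connected_graph adj := forall i j, connect adj i j.

Definition regular_graph adj d := forall i, #|[set j | adj j i]| = d.

Definition common_nbrs adj i j : nat := #|[set k | adj k i && adj k j]|.

Definition adjacency_mx adj : 'M[R]_n := \matrix_(i, j) (adj i j)%:R.

(* The eigenvalues, repeated according to multiplicity as roots of the
   characteristic polynomial, in nonincreasing order. *)
Definition ordered_eigenvalues (A : 'M[R]_n) (lam : n.-tuple R) :=
  sorted >=%R lam /\ char_poly A = \prod_(x <- lam) ('X - x%:P).

(* d - N(i,j), computed in R because subtraction on nat truncates. *)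
Definition codeg adj d i j : R := d%:R - (common_nbrs adj i j)%:R.

(* The case in which j is adjacent to i and k is not. *)
Definition alpha_mixed adj d i j k : R :=
  - 2^-1 - Num.sqrt (4^-1 + 4 * (codeg adj d i j - 1) * codeg adj d i k).

Definition beta_mixed adj d i j k : R :=
  - 2^-1 + Num.sqrt (4^-1 + 4 * (codeg adj d i j - 1) * codeg adj d i k).

Definition alpha adj d i j k : R :=
  match adj j i, adj k i with
  | true, true =>
      - 1 - 2 * Num.sqrt ((codeg adj d i j - 1) * (codeg adj d i k - 1))
  | false, false => - 2 * Num.sqrt (codeg adj d i j * codeg adj d i k)
  | true, false => alpha_mixed adj d i j k
  | false, true => alpha_mixed adj d i k j
  end.

Definition beta adj d i j k : R :=
  match adj j i, adj k i with
  | true, true =>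
      - 1 + 2 * Num.sqrt ((codeg adj d i j - 1) * (codeg adj d i k - 1))
  | false, false => 2 * Num.sqrt (codeg adj d i j * codeg adj d i k)
  | true, false => beta_mixed adj d i j k
  | false, true => beta_mixed adj d i k j
  end.

Definition distinct_pairs i : {set 'I_n * 'I_n} :=
  [set p | [&& p.1 != i, p.2 != i & p.1 != p.2]].

End Graph.

(* Main.v *)
(* Fix a vertex i. Modulo the all-ones vector, A acts with the eigenvalues
   lambda_2, ..., lambda_n, and on representatives y with y_i = 0 it is given by
   the matrix with entries a_jk - a_ik (j, k <> i). Its diagonal entries are
   - a_ij and the absolute off-diagonal sum of row j is 2 (d - N(i,j) - a_ij),
   so Brauer's ovals of Cassini put each of these eigenvalues between some
   alpha_ijk and the corresponding beta_ijk. *)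

Require Import Defs.
From mathcomp Require Import all_boot all_order all_algebra.
From mathcomp Require Import ring lra.

Set Implicit Arguments.
Unset Strict Implicit.
Unset Printing Implicit Defensive.

Import Order.TTheory GRing.Theory Num.Theory.
Local Open Scope ring_scope.

(** * Linear algebra: matrices with constant row sums, and Brauer's ovals *)

Lemma char_poly_tr (R : comNzRingType) n (A : 'M[R]_n) :
  char_poly A^T = char_poly A.
Proof.
by rewrite /char_poly -[in RHS]det_tr /char_poly_mx linearB /= tr_scalar_mx map_trmx.
Qed.

(** Asking for determinant 1 avoids inverting [P]: both sides are multiplied by [\det P], and [P]
    moves across the characteristic matrix. *)
Lemma char_poly_conj (R : comNzRingType) n (A B P : 'M[R]_n) :
  \det P = 1 -> A *m P = P *m B -> char_poly A = char_poly B.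
Proof.
move=> detP AP; rewrite /char_poly.
have detP' : \det (map_mx polyC P) = 1 by rewrite det_map_mx detP.
rewrite -[LHS]mulr1 -[RHS]mul1r -detP' -!det_mulmx /char_poly_mx.
by rewrite mulmxBl mulmxBr scalar_mxC -!map_mxM /= AP.
Qed.

Lemma char_poly_ublock (R : comNzRingType) m n (A : 'M[R]_m) (B : 'M[R]_(m, n))
    (C : 'M[R]_n) :
  char_poly (block_mx A B 0 C) = char_poly A * char_poly C.
Proof.
rewrite /char_poly -(det_ublock _ (- map_mx polyC B)) /char_poly_mx.
by rewrite map_block_mx scalar_mx_block opp_block_mx add_block_mx map_mx0 oppr0 add0r addr0.
Qed.

(* Action of A on column vectors modulo the all-ones vector, on representatives
   with first entry 0, when A has constant row sums. *)
Definition row_sum_quot_mx (R : pzRingType) m (A : 'M[R]_(1 + m)) : 'M[R]_m :=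
  drsubmx A - const_mx 1 *m ursubmx A.

Lemma char_poly_row_sum (R : comNzRingType) m (A : 'M[R]_(1 + m)) (d : R) :
  A *m const_mx 1 = const_mx d :> 'cV_(1 + m) ->
  char_poly A = ('X - d%:P) * char_poly (row_sum_quot_mx A).
Proof.
move=> Ad; have -> : 'X - d%:P = char_poly (d%:M : 'M_1).
  by rewrite /char_poly /char_poly_mx map_scalar_mx -raddfB /= det_scalar1.
rewrite -(char_poly_ublock _ (ursubmx A)).
(* Base change replacing the first basis vector by the all-ones vector, which spans an invariant
   line with eigenvalue [d]; the lower right block becomes the quotient matrix. *)
apply: (@char_poly_conj _ _ _ _ (block_mx 1%:M 0 (const_mx 1) 1%:M)).
  by rewrite det_lblock !det1 mul1r.
have e1 : const_mx 1 = 1%:M :> 'M[R]_1.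
  by apply/matrixP => i j; rewrite !mxE !ord1.
move: Ad; rewrite -[in A *m _](submxK A) -!col_mx_const mul_block_col e1.
rewrite !mulmx1 => /eq_col_mx[Eu Ed].
rewrite -[in LHS](submxK A) !mulmx_block.
rewrite !mulmx1 !mulmx0 !mul1mx !mul0mx !add0r !addr0 Eu Ed.
rewrite (_ : const_mx 1 *m ursubmx A + row_sum_quot_mx A = drsubmx A); last first.
  by rewrite addrC subrK.
congr block_mx.
- by apply/matrixP => i j; rewrite !mxE !ord1.
- by rewrite mul_mx_scalar; apply/matrixP => i j; rewrite !mxE mulr1.
Qed.

(** An eigenvector of the quotient matrix, padded with a zero first entry, is an eigenvector of [A]
    up to a constant vector; [c] is read off from the first row. The transpose is there because
    [eigenvalueP] speaks of row vectors. *)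
Lemma row_sum_quot_eigen (F : fieldType) m (A : 'M[F]_(1 + m)) (a : F) :
  root (char_poly (row_sum_quot_mx A)) a ->
  exists (z : 'cV_(1 + m)) (c : F),
    [/\ A *m z = a *: z + const_mx c, z 0 0 = 0 & z != 0].
Proof.
rewrite -char_poly_tr -eigenvalue_root_char => /eigenvalueP[v vE v0].
exists (col_mx 0 v^T), ((ursubmx A *m v^T) 0 0); split.
- rewrite -[A in LHS]submxK mul_block_col !mulmx0 !add0r -col_mx_const.
  rewrite scale_col_mx add_col_mx scaler0 add0r; congr col_mx.
    by apply/matrixP => i j; rewrite !mxE !ord1.
  move/(congr1 trmx): vE; rewrite trmx_mul trmxK linearZ /= => <-.
  rewrite /row_sum_quot_mx mulmxBl -mulmxA -addrA.
  rewrite [X in _ + X](_ : _ = 0) ?addr0 //.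
  apply/matrixP => i j; rewrite !mxE big_ord1 !mxE !ord1 mul1r; exact: addNr.
- by rewrite mxE; case: splitP => k; rewrite ?mxE.
- apply: contraNneq v0; rewrite -col_mx0 => /eq_col_mx[_ v0].
  by rewrite -[v]trmxK v0 trmx0.
Qed.

(* The two largest entries of |y| give the pair of rows; the eigenvector
   equation is bounded in each of them by the other entry. *)
Lemma brauer_oval (R : realDomainType) (T : finType) (S : {set T})
    (M : T -> T -> R) (y : T -> R) (a : R) :
  (1 < #|S|)%N -> (exists2 j, j \in S & y j != 0) ->
  {in S, forall j, (a - M j j) * y j = \sum_(k in S | k != j) M j k * y k} ->
  exists j k, [/\ j \in S, k \in S, j != k &
    `|a - M j j| * `|a - M k k| <=
      (\sum_(l in S | l != j) `|M j l|) * (\sum_(l in S | l != k) `|M k l|)].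
Proof.
move=> S_gt1 [j0 j0S yj0] eigS.
have bound j b : j \in S -> {in S, forall l, l != j -> `|y l| <= b} ->
    `|a - M j j| * `|y j| <= (\sum_(l in S | l != j) `|M j l|) * b.
  move=> jS yb; rewrite -normrM eigS // mulr_suml.
  apply: le_trans (ler_norm_sum _ _ _) _; apply: ler_sum => l /andP[lS lj].
  by rewrite normrM ler_wpM2l // yb.
have [j jS jmax] : exists2 j, j \in S & {in S, forall l, `|y l| <= `|y j|}.
  by case: (Order.TotalTheory.arg_maxP (fun l => `|y l|) j0S) => j; exists j.
have yj : 0 < `|y j| by apply: lt_le_trans (jmax _ j0S); rewrite normr_gt0.
have [k0 k0S] : exists k, k \in S :\ j.
  by apply/card_gt0P; move: S_gt1; rewrite (cardsD1 j) jS.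
have [k] : exists2 k, k \in S :\ j & {in S :\ j, forall l, `|y l| <= `|y k|}.
  by case: (Order.TotalTheory.arg_maxP (fun l => `|y l|) k0S) => k; exists k.
rewrite !inE => /andP[kj kS] kmax.
exists j, k; split; rewrite // 1?eq_sym //.
have Bj : `|a - M j j| * `|y j| <= (\sum_(l in S | l != j) `|M j l|) * `|y k|.
  by apply: bound => // l lS lj; apply: kmax; rewrite !inE lj.
have Bk : `|a - M k k| * `|y k| <= (\sum_(l in S | l != k) `|M k l|) * `|y j|.
  by apply: bound => // l lS _; apply: jmax.
(* If the second largest entry is 0, the bound in row [j] forces [a = M j j]. Otherwise the two
   bounds are multiplied and the positive factor [|y j| * |y k|] is cancelled. *)
have [yk0|yk0] := eqVneq (y k) 0.
  have : `|a - M j j| * `|y j| <= 0 by rewrite (le_trans Bj) // yk0 normr0 mulr0.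
  rewrite pmulr_lle0 // normr_le0 => /eqP ->.
  by rewrite normr0 mul0r mulr_ge0 // sumr_ge0.
have yk : 0 < `|y k| by rewrite normr_gt0.
rewrite -(ler_pM2r (mulr_gt0 yj yk)).
by have := ler_pM _ _ Bj Bk; rewrite !mulr_ge0 //; move=> /(_ isT isT); lra.
Qed.

(** * Oval bounds for a regular graph *)

Section Oval.
Variables (R : rcfType) (n : nat) (adj : rel 'I_n) (d : nat).
Hypotheses (sym : symmetric adj) (irr : irreflexive adj).
Hypothesis reg : regular_graph adj d.

Lemma regular_row_sum j : \sum_k (adj j k)%:R = d%:R :> R.
Proof.
rewrite -natr_sum; congr _%:R; rewrite -(reg j) -sum1dep_card [RHS]big_mkcond /=.
by apply: eq_bigr => k _; rewrite sym; case: (adj k j).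
Qed.

Lemma codeg_sum i j : i != j ->
  \sum_(k in [set~ i] | k != j) `|(adj j k)%:R - (adj i k)%:R|
    = 2 * (codeg R adj d i j - (adj i j)%:R) :> R.
Proof.
move=> ij.
(* For 0/1 values, [|x - y| = x + y - 2xy], so the sum over all [k] is 2d - 2N(i,j). The terms
   [k = i] and [k = j], removed afterwards, are each equal to [adj i j]. *)
have tot : \sum_k `|(adj j k)%:R - (adj i k)%:R| = 2 * codeg R adj d i j :> R.
  have -> : (codeg R adj d i j) = d%:R - \sum_k (adj i k)%:R * (adj j k)%:R.
    rewrite /codeg; congr (_ - _); rewrite /common_nbrs -sum1dep_card big_mkcond /=.
    rewrite natr_sum; apply: eq_bigr => k _; rewrite ![adj k _]sym.
    by case: (adj i k); case: (adj j k); rewrite /= ?mulr0 ?mulr1.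
  apply: (@etrans _ _ (d%:R + d%:R - 2 * \sum_k (adj i k)%:R * (adj j k)%:R)); last by ring.
  rewrite -{1}(regular_row_sum i) -(regular_row_sum j) mulr_sumr -big_split -sumrB /=.
  apply: eq_bigr => k _.
  by case: (adj i k); case: (adj j k); rewrite ?subrr ?sub0r ?subr0 ?normrN ?normr0 ?normr1 /=; ring.
move: tot; rewrite (bigD1 i) //= (bigD1 j) 1?eq_sym //=.
rewrite !irr sub0r subr0 normrN !normr_nat (sym j i).
under [in X in _ -> X]eq_bigl => k do rewrite !inE.
lra.
Qed.

Lemma oval (z : 'cV[R]_n) (a c : R) i : (1 < n.-1)%N ->
  adjacency_mx R adj *m z = a *: z + const_mx c ->
  (exists j, z j 0 != z i 0) ->
  exists j k, [/\ j != i, k != i, j != k &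
    `|a + (adj i j)%:R| * `|a + (adj i k)%:R| <=
     4 * (codeg R adj d i j - (adj i j)%:R) * (codeg R adj d i k - (adj i k)%:R)].
Proof.
move=> n_gt2 zE [j0 zj0].
pose y j := z j 0 - z i 0.
have zEj j : \sum_k (adj j k)%:R * z k 0 = a * z j 0 + c.
  move/matrixP/(_ j 0): zE; rewrite !mxE => <-.
  by apply: eq_bigr => k _; rewrite !mxE.
(* Subtracting row [i] from row [j] removes [c]; as all row sums agree, [z] may be replaced by its
   shift [y], which vanishes at [i]. Hence any [i] may serve as base vertex. *)
have yE j : a * y j = \sum_k ((adj j k)%:R - (adj i k)%:R) * y k.
  rewrite /y.
  under eq_bigr do rewrite mulrBr [_ * z i 0]mulrBl mulrBl.
  rewrite !sumrB -!mulr_suml !regular_row_sum !zEj; ring.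
have [j [k []]] : exists j k, [/\ j \in [set~ i], k \in [set~ i], j != k &
    `|a - ((adj j j)%:R - (adj i j)%:R)| * `|a - ((adj k k)%:R - (adj i k)%:R)| <=
      (\sum_(l in [set~ i] | l != j) `|(adj j l)%:R - (adj i l)%:R|)
    * (\sum_(l in [set~ i] | l != k) `|(adj k l)%:R - (adj i l)%:R|)].
  apply: (@brauer_oval R _ _ (fun j k => (adj j k)%:R - (adj i k)%:R) y).
  - by rewrite cardsC1 card_ord.
  - exists j0; last by rewrite subr_eq0.
    by rewrite !inE; apply: contraNneq zj0 => ->.
  move=> j; rewrite !inE => ji; rewrite mulrBl yE (bigD1 i) //= (bigD1 j) //=.
  rewrite {1}/y subrr mulr0 add0r addrAC subrr add0r.
  by apply: eq_bigl => k; rewrite !inE.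
rewrite !inE => ji ki jk; rewrite !irr !sub0r !opprK !codeg_sum 1?eq_sym // => H.
by exists j, k; split=> //; apply: le_trans H _; lra.
Qed.

Lemma alpha_beta_oval (a : R) i j k :
  `|a + (adj i j)%:R| * `|a + (adj i k)%:R| <=
    4 * (codeg R adj d i j - (adj i j)%:R) * (codeg R adj d i k - (adj i k)%:R) ->
  alpha R adj d i j k <= a <= beta R adj d i j k.
Proof.
have sq (x b : R) : x ^+ 2 <= b -> - Num.sqrt b <= x <= Num.sqrt b.
  by move=> /ler_wsqrtr; rewrite sqrtr_sqr ler_norml.
have sq2 (x u v : R) : `|x| * `|x| <= 4 * u * v ->
    - (2 * Num.sqrt (u * v)) <= x <= 2 * Num.sqrt (u * v).
  rewrite -normrM ger0_norm -?expr2 ?sqr_ge0 // => H.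
  have /sq : (x / 2) ^+ 2 <= u * v by lra.
  by case/andP=> *; apply/andP; split; lra.
(* Here the two disc centres are -1 and 0; completing the square in [b * (b + 1)] gives the
   constants 1/2 and 1/4. *)
have mixed (b u v : R) : `|b + 1| * `|b| <= 4 * u * v ->
   - 2^-1 - Num.sqrt (4^-1 + 4 * u * v) <= b <= - 2^-1 + Num.sqrt (4^-1 + 4 * u * v).
  rewrite -normrM => /(le_trans (ler_norm _)) H.
  have /sq : (b + 2^-1) ^+ 2 <= 4^-1 + 4 * u * v by lra.
  by case/andP=> *; apply/andP; split; lra.
rewrite /alpha /beta /alpha_mixed /beta_mixed !(sym _ i).
case: (adj i j); case: (adj i k); rewrite /= ?addr0 ?subr0 => H.
- by case/sq2/andP: H => *; apply/andP; split; lra.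
- exact: mixed H.
- apply: mixed; rewrite mulrC; apply: le_trans H _; lra.
- by case/sq2/andP: H => *; apply/andP; split; lra.
Qed.

(** Settles the lower bound when the least eigenvalue equals [d], since then [alpha] is at most 0
    and 0 is at most [d]. *)
Lemma alpha_le0 i j k : alpha R adj d i j k <= 0.
Proof.
rewrite /alpha /alpha_mixed; have s0 := @sqrtr_ge0 R.
by case: (adj j i); case: (adj k i);
  match goal with |- context [Num.sqrt ?x] => have := s0 x end; lra.
Qed.

End Oval.

Lemma quot_root_oval (R : rcfType) m d (adj : rel 'I_(1 + m)) (a : R) :
  (1 < m)%N -> simple_graph adj -> regular_graph adj d ->
  root (char_poly (row_sum_quot_mx (adjacency_mx R adj))) a ->
  forall i, exists2 p, p \in distinct_pairs i &
    alpha R adj d i p.1 p.2 <= a <= beta R adj d i p.1 p.2.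
Proof.
move=> m_gt1 [sym irr] reg /row_sum_quot_eigen[z [c [zE z0 zn0]]] i.
(* A constant [z] would be zero, because its first entry is 0. *)
have zi : exists j, z j 0 != z i 0.
  apply/existsP; apply: contraNT zn0; rewrite negb_exists => /forallP zi.
  have {}zi j : z j 0 = z i 0 by apply/eqP; have := zi j; rewrite negbK.
  by apply/eqP/matrixP => j l; rewrite ord1 mxE zi -(zi 0) z0.
have [j [k [ji ki jk H]]] := oval sym irr reg m_gt1 zE zi.
by exists (j, k); [rewrite inE /= ji ki | exact: alpha_beta_oval].
Qed.

(** * Extrema over finite sets, and the eigenvalue bounds *)

Lemma maxs_le (R : realDomainType) (T : finType) (A : {pred T}) (f : T -> R) b :
  (exists x, x \in A) -> {in A, forall x, f x <= b} ->
  maxs [seq f x | x in A] <= b.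
Proof.
move=> [x0 x0A] fb.
have /maxs_mem/imageP[x xA ->] : [seq f x | x in A] != [::]; last exact: fb.
by apply: contraTneq (image_f f x0A) => ->.
Qed.

Lemma le_mins (R : realDomainType) (T : finType) (A : {pred T}) (f : T -> R) b :
  (exists x, x \in A) -> {in A, forall x, b <= f x} ->
  b <= mins [seq f x | x in A].
Proof.
move=> [x0 x0A] fb.
have /mins_mem/imageP[x xA ->] : [seq f x | x in A] != [::]; last exact: fb.
by apply: contraTneq (image_f f x0A) => ->.
Qed.

Lemma distinct_pairs_ex n (i : 'I_n) : (2 < n)%N -> exists p, p \in distinct_pairs i.
Proof.
move=> n_gt2.
have /card_gt1P[j [k [ji ki jk]]] : (1 < #|[set~ i]|)%N.
  by rewrite cardsC1 card_ord; case: n n_gt2 {i}.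
by exists (j, k); move: ji ki; rewrite !inE /= jk => -> ->.
Qed.

Theorem theorem3p9 (R : rcfType) (n d : nat) (adj : rel 'I_n)
    (lam : n.-tuple R) (hn : (3 <= n)%N) (hG : simple_graph adj)
    (hconn : connected_graph adj) (hreg : regular_graph adj d)
    (hlam : ordered_eigenvalues (adjacency_mx R adj) lam) :
  [/\ maxs [seq mins [seq alpha R adj d i p.1 p.2 | p in distinct_pairs i]
           | i : 'I_n] <= lam`_n.-1,
      lam`_n.-1 <= lam`_1
    & lam`_1 <= mins [seq maxs [seq beta R adj d i p.1 p.2
                               | p in distinct_pairs i] | i : 'I_n]].
Proof.
case: n adj lam hn hG hconn hreg hlam => [|[|[|m]]] // adj lam hn hG _ hreg.
case=> lam_sorted lamE; have sz := size_tuple lam.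
have le_lam i j : (i <= j < m.+3)%N -> lam`_j <= lam`_i.
  case/andP=> ij jm; apply: (sorted_leq_nth (rev_trans le_trans) lexx) => //.
  - by rewrite inE sz (leq_ltn_trans ij).
  - by rewrite inE sz.
set q := char_poly (row_sum_quot_mx (adjacency_mx R adj : 'M_(1 + m.+2))).
have qE : \prod_(x <- lam) ('X - x%:P) = ('X - d%:R%:P) * q.
  rewrite -lamE; apply: char_poly_row_sum; apply/matrixP => i j.
  rewrite !mxE -(regular_row_sum R (proj1 hG) hreg i).
  by apply: eq_bigr => k _; rewrite !mxE mulr1.
have q_root i : (i < m.+3)%N -> lam`_i != d%:R -> root q lam`_i.
  move=> im lam_d; have : root (\prod_(x <- lam) ('X - x%:P)) lam`_i.
    by rewrite root_prod_XsubC mem_nth // sz.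
  by rewrite qE rootM root_XsubC (negPf lam_d).
(* If [d] occurs twice, cancelling one factor ['X - d] leaves it as a root of [q]. *)
have q_dbl : lam`_0 = d%:R -> lam`_1 = d%:R -> root q d%:R.
  move: qE sz; case: (tval lam) => [|x [|y s]] //= qE _ xd yd.
  have Xd0 : 'X - d%:R%:P != 0 :> {poly R} by rewrite polyXsubC_eq0.
  move: qE; rewrite !big_cons xd yd => /(mulfI Xd0) <-.
  by rewrite rootM root_XsubC eqxx.
have bounds := @quot_root_oval R _ _ _ _ (isT : (1 < m.+2)%N) hG hreg.
split; last 2 first.
- by apply: le_lam; rewrite /= ltnSn.
(* Indices start at 0, so [lam]_1[is the second largest eigenvalue. Any root of]q[above it suffices:
   itself if it differs from]d[, else]lam[_0], which is either a root other than [d] or a second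
   copy of [d]. So [d] need not be identified as the largest eigenvalue. *)
- have [a lam_a qa] : exists2 a, lam`_1 <= a & root q a.
    have [l1|l1] := eqVneq lam`_1 d%:R; last by exists lam`_1; rewrite ?q_root.
    have [l0|l0] := eqVneq lam`_0 d%:R.
      by exists d%:R; rewrite ?l1 // q_dbl.
    by exists lam`_0; rewrite ?q_root // le_lam.
  apply: le_mins => [|i _]; first by exists ord0.
  have [p pi /andP[_ ab]] := bounds _ qa i.
  apply: le_trans lam_a (le_trans ab _).
  by apply: maxs_ub; apply/imageP; exists p.
- apply: maxs_le => [|i _]; first by exists ord0.
  have [p pi pa] : exists2 p, p \in distinct_pairs i & alpha R adj d i p.1 p.2 <= lam`_m.+2.
    (* If the last eigenvalue differs from [d], it is a root of [q]; if it equals [d], every pair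
       works. *)
    have [ld|ld] := eqVneq lam`_m.+2 d%:R; last first.
      by have [p pi /andP[]] := bounds _ (q_root _ (ltnSn _) ld) i; exists p.
    have [p pi] := distinct_pairs_ex i hn; exists p => //.
    by rewrite ld; apply: le_trans (alpha_le0 _ _ _ _ _ _) (ler0n _ _).
  by apply: le_trans pa; apply: mins_lb; apply/imageP; exists p.
Qed.
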